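(* If \textsc{Equal-Subset-Sum} on $n$ integers can be solved in time $\mathcal{O}^{*}((2-\varepsilon)^{0.25n})$ for some constant $\varepsilon>0$, then \textsc{Subset-Sum} on $n$ integers can be solved in time $\mathcal{O}^{*}((2-\varepsilon')^{0.5n})$ for some constant $\varepsilon'>0$.
   Context: \textsc{Equal-Subset-Sum}: given a set $S$ of $n$ integers, decide whether there exist two disjoint nonempty subsets $A,B\subseteq S$ with $\sum_{x\in A}x=\sum_{x\in B}x$. \textsc{Subset-Sum}: given a set $S$ of $n$ integers and a target integer $t$, decide whether some subset of $S$ has sum exactly $t$. The notation $\mathcal{O}^{*}(\cdot)$ hides factors polynomial in the input size. *)

(* Defs.v *)
From mathcomp Require Import all_boot all_order all_algebra.
From mathcomp Require Import finmap reals exp.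

Set Implicit Arguments.
Unset Strict Implicit.
Unset Printing Implicit Defensive.

Import Order.TTheory GRing.Theory Num.Theory.
Local Open Scope ring_scope.

(* Deterministic random access machine with logarithmic cost.  A single        *)
(* memory of integer cells, addressed by integers (negative addresses are      *)
(* ordinary cells), serves both as register file and as storage.  Every        *)
(* elementary step is charged the bit lengths of all the addresses and         *)
(* contents that it handles.  Addition and subtraction are the only arithmetic *)
(* primitives: multiplication, division and bit operations are programmable    *)
(* in time polynomial in the length of their operands, whereas charging them   *)
(* linearly would be too generous on very long integers.  Structured control   *)
(* flow simulates jumps at a constant factor.                                  *)

Definition memory := int -> int.

Definition update (m : memory) (a v : int) : memory :=
  fun b => if b == a then v else m b.

Inductive program :=
| Skip
| Const (i c : int)                      (* M[i] := c *)
| Add (i j k : int)                      (* M[i] := M[j] + M[k] *)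
| Sub (i j k : int)                      (* M[i] := M[j] - M[k] *)
| Read (i j : int)                       (* M[i] := M[M[j]] *)
| Write (i j : int)                      (* M[M[i]] := M[j] *)
| Seq (p q : program)
| If (i : int) (p q : program)           (* if M[i] > 0 then p else q *)
| While (i : int) (p : program).         (* while M[i] > 0 do p *)

(* Number of binary digits of |x|, with bitlen 0 = 1. *)
Definition bitlen (x : int) : nat := (trunc_log 2 `|x|).+1.

(* exec p m t m': started in memory m, p halts in memory m' after time t. *)
Inductive exec : program -> memory -> nat -> memory -> Prop :=
| ExecSkip m :
    exec Skip m 1 m
| ExecConst i c m :
    exec (Const i c) m (bitlen i + bitlen c) (update m i c)
| ExecAdd i j k m :
    exec (Add i j k) m
      (bitlen i + bitlen j + bitlen k + bitlen (m j) + bitlen (m k))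
      (update m i (m j + m k))
| ExecSub i j k m :
    exec (Sub i j k) m
      (bitlen i + bitlen j + bitlen k + bitlen (m j) + bitlen (m k))
      (update m i (m j - m k))
| ExecRead i j m :
    exec (Read i j) m
      (bitlen i + bitlen j + bitlen (m j) + bitlen (m (m j)))
      (update m i (m (m j)))
| ExecWrite i j m :
    exec (Write i j) m
      (bitlen i + bitlen j + bitlen (m i) + bitlen (m j))
      (update m (m i) (m j))
| ExecSeq p q m1 m2 m3 t u :
    exec p m1 t m2 -> exec q m2 u m3 -> exec (Seq p q) m1 (t + u) m3
| ExecIfTrue i p q m m' t :
    0 < m i -> exec p m t m' ->
    exec (If i p q) m (bitlen i + bitlen (m i) + t) m'
| ExecIfFalse i p q m m' t :
    m i <= 0 -> exec q m t m' ->
    exec (If i p q) m (bitlen i + bitlen (m i) + t) m'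
| ExecWhileTrue i p m1 m2 m3 t u :
    0 < m1 i -> exec p m1 t m2 -> exec (While i p) m2 u m3 ->
    exec (While i p) m1 (bitlen i + bitlen (m1 i) + t + u) m3
| ExecWhileFalse i p m :
    m i <= 0 -> exec (While i p) m (bitlen i + bitlen (m i)) m.

(* An input word fills the cells 0, 1, 2, ...; all other cells hold 0. *)
Definition init (w : seq int) : memory :=
  fun a => if a is Posz k then nth 0 w k else 0.

Record problem := Problem {
  instance : Type;
  num_integers : instance -> nat;
  encode : instance -> seq int;
  answer : instance -> Prop
}.

Definition input_size (Q : problem) (x : instance Q) : nat :=
  (\sum_(a <- encode x) bitlen a)%N.

(* Q is solvable in time O^*(T n), n being the number of integers: a single    *)
(* program decides every instance, leaving 1 (yes) or 0 (no) in cell 0, within *)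
(* time (C * input_size ^ d) * T n for constants C and d.                      *)
Definition solvable_in_Ostar (R : realType) (Q : problem) (T : nat -> R) : Prop :=
  exists (p : program) (C d : nat), forall x : instance Q,
  exists (t : nat) (m : memory),
    [/\ exec p (init (encode x)) t m,
        answer x -> m 0 = 1,
        ~ answer x -> m 0 = 0
      & t%:R <= (C * input_size x ^ d)%:R * T (num_integers x)].

(* A finite set of integers is presented to a program as a duplicate-free list *)
(* in arbitrary order.                                                         *)
Definition listed_set := {s : seq int | uniq s}.

Definition set_of (s : listed_set) : {fset int} := [fset x in val s]%fset.

Definition has_equal_subset_sums (S : {fset int}) : Prop :=
  exists A B : {fset int},
    [/\ (A `<=` S)%fset /\ (B `<=` S)%fset, [disjoint A & B]%fset,
        A != fset0, B != fset0 & \sum_(x <- A) x = \sum_(x <- B) x].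

Definition has_subset_sum (S : {fset int}) (t : int) : Prop :=
  exists2 A : {fset int}, (A `<=` S)%fset & \sum_(x <- A) x = t.

Definition EqualSubsetSum : problem :=
  {| instance := listed_set;
     num_integers := fun s => size (val s);
     encode := fun s => (size (val s))%:Z :: val s;
     answer := fun s => has_equal_subset_sums (set_of s) |}.

Definition SubsetSum : problem :=
  {| instance := (listed_set * int)%type;
     num_integers := fun x => size (val x.1);
     encode := fun x => (size (val x.1))%:Z :: x.2 :: val x.1;
     answer := fun x => has_subset_sum (set_of x.1) x.2 |}.

(* Main.v *)
Require Import Defs.
From mathcomp Require Import all_boot all_order all_algebra.
From mathcomp Require Import finmap reals exp.
From mathcomp Require Import boolp zify ring lra.

(* An instance (a_0, ..., a_(n-1); t) of Subset-Sum is turned into an instance *)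
(* of Equal-Subset-Sum with 2 n + 3 integers.  Put M = 1 + 2 |t| + 2 sum |a_i|,*)
(* H = 2 t - sum a_i and w_i = M 8^(i+1), and take                             *)
(*   T = H + 3 M + sum w_i,  p_i = a_i + w_i,  q_i = 2 w_i,  M  and  2 M.      *)
(* Two disjoint subsets of equal sum are a nonzero assignment of signs -1, 0,  *)
(* 1 to these numbers with signed sum 0.  As M exceeds all low-order parts and *)
(* the base-8 digits are at most 6 in absolute value, every digit vanishes:    *)
(*   3 e + z + 2 z' = 0  and  e + x_i + 2 y_i = 0,                             *)
(* where e, x_i, y_i, z, z' are the signs of T, p_i, q_i, M, 2 M.  If e = 0,   *)
(* then all signs are 0.  Otherwise z = z' = - e and each x_i is odd, hence a  *)
(* free sign 1 or -1 (y_i makes up for it), and the low-order part             *)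
(* e H + sum x_i a_i = 0 says that the a_i with x_i = - e sum to t.  Finally   *)
(* (2 - eps)^((2 n + 3) / 4) is (2 - eps)^(n / 2) up to a constant factor.     *)

(** Replacing [n] integers by [2 n + 3] makes a quarter of the new count equal to [n / 2 + 3 / 4],
    so the assumed exponent becomes the wanted one, and [powR_quarter_le] loses only a factor 2.
    Correctness is [reduction_correct]: [equal_subset_sums_signs] turns pairs of disjoint subsets
    into signs and [items_zero_sum] solves the digit equations. On the machine, [runs_reduction]
    builds the new instance in linearly many elementary steps. As contents grow by at most one bit
    per step, both the cost and the size of the new instance are quadratic in the old input size,
    which the polynomial factor absorbs. *)

Set Implicit Arguments.
Unset Strict Implicit.
Unset Printing Implicit Defensive.

Import Order.TTheory GRing.Theory Num.Theory.
Local Open Scope ring_scope.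

(** * Step counting on the random access machine *)

(* [p] makes at most [k] elementary steps.  Each of them lengthens the longest *)
(* content by at most one bit, so that counting steps is enough to bound the   *)
(* logarithmic cost.                                                           *)
Definition runs (k : nat) (p : program) (m m' : memory) : Prop :=
  forall L : nat, (4 <= L)%N -> (forall a, (bitlen (m a) <= L)%N) ->
  (exists2 t : nat, exec p m t m' & (t <= 5 * k * (L + k))%N) /\
  (forall a, (bitlen (m' a) <= L + k)%N).

Lemma bitlen_le (x : int) (L : nat) : (0 < L)%N -> (`|x| < 2 ^ L)%N -> (bitlen x <= L)%N.
Proof.
move=> L0 xL; rewrite /bitlen; case: (posnP `|x|%N) => [->|x0] //.
by rewrite -(ltn_exp2l _ _ (isT : 1 < 2)%N) (leq_ltn_trans _ xL) // trunc_logP.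
Qed.

Lemma lt_exp_bitlen (x : int) : (`|x| < 2 ^ bitlen x)%N.
Proof. exact: trunc_log_ltn. Qed.

Lemma bitlen_addsub (x y : int) (L : nat) :
  (bitlen x <= L)%N -> (bitlen y <= L)%N ->
  (bitlen (x + y) <= L.+1)%N /\ (bitlen (x - y) <= L.+1)%N.
Proof.
move=> xL yL.
have {}xL : (`|x| < 2 ^ L)%N.
  by apply: leq_trans (lt_exp_bitlen x) _; rewrite leq_exp2l.
have {}yL : (`|y| < 2 ^ L)%N.
  by apply: leq_trans (lt_exp_bitlen y) _; rewrite leq_exp2l.
by split; apply: bitlen_le; rewrite // expnS; lia.
Qed.

(** The 5 is the largest number of lengths charged to one instruction: three addresses and two
    contents in [Add] and [Sub]. *)
Lemma runs_update (p : program) (m : memory) (i v : int) (t : nat) :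
  exec p m t (update m i v) ->
  (forall L : nat, (4 <= L)%N -> (forall a, (bitlen (m a) <= L)%N) ->
    (t <= 5 * L)%N /\ (bitlen v <= L.+1)%N) ->
  runs 1 p m (update m i v).
Proof.
move=> pt H L L4 mL; have [tL vL] := H L L4 mL; split; first by exists t => //; lia.
move=> a; rewrite /update addn1; case: ifP => // _.
exact: leqW.
Qed.

Lemma runs_le (k k' : nat) (p : program) (m m' : memory) :
  (k <= k')%N -> runs k p m m' -> runs k' p m m'.
Proof.
move=> kk' H L L4 mL; have [[t pt tk] mL'] := H L L4 mL; split.
  by exists t => //; apply: leq_trans tk _; rewrite leq_mul ?leq_add2l ?leq_mul.
by move=> a; apply: leq_trans (mL' a) _; rewrite leq_add2l.
Qed.

(** The second program starts from contents of length [L + k], and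
    [5 * k * (L + k) + 5 * l * (L + k + l)] is at most [5 * (k + l) * (L + k + l)]. *)
Lemma runs_seq (k l : nat) (p q : program) (m1 m2 m3 : memory) :
  runs k p m1 m2 -> runs l q m2 m3 -> runs (k + l) (Seq p q) m1 m3.
Proof.
move=> Hp Hq L L4 mL; have [[t pt tk] mL'] := Hp L L4 mL.
have [[u qu ul] mL''] := Hq (L + k)%N (leq_trans L4 (leq_addr _ _)) mL'.
split; last by move=> a; rewrite addnA.
exists (t + u)%N; first exact: ExecSeq pt qu.
nia.
Qed.

Lemma runs_skip (m : memory) : runs 1 Skip m m.
Proof.
move=> L L4 mL; split; first by exists 1%N; [exact: ExecSkip | lia].
by move=> a; apply: leq_trans (mL a) _; rewrite leq_addr.
Qed.

Lemma runs_if (k : nat) (i : int) (p q : program) (m m' : memory) :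
  (bitlen i <= 4)%N -> runs k (if 0 < m i then p else q) m m' ->
  runs k.+1 (If i p q) m m'.
Proof.
move=> i4 H L L4 mL; have [[t pt tk] mL'] := H L L4 mL.
split; last by move=> a; apply: leq_trans (mL' a) _; lia.
exists (bitlen i + bitlen (m i) + t)%N; last by have := mL i; nia.
case: ltP pt => mi pt; [exact: ExecIfTrue | exact: ExecIfFalse].
Qed.

Lemma runs_while_stop (i : int) (p : program) (m : memory) :
  (bitlen i <= 4)%N -> m i <= 0 -> runs 1 (While i p) m m.
Proof.
move=> i4 mi L L4 mL; split; last by move=> a; apply: leq_trans (mL a) _; lia.
exists (bitlen i + bitlen (m i))%N; first exact: ExecWhileFalse.
by have := mL i; nia.
Qed.

Lemma runs_while_step (k l : nat) (i : int) (p : program) (m1 m2 m3 : memory) :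
  (bitlen i <= 4)%N -> 0 < m1 i -> runs k p m1 m2 -> runs l (While i p) m2 m3 ->
  runs (k + l).+1 (While i p) m1 m3.
Proof.
move=> i4 mi Hp Hq L L4 mL; have [[t pt tk] mL'] := Hp L L4 mL.
have [[u qu ul] mL''] := Hq (L + k)%N (leq_trans L4 (leq_addr _ _)) mL'.
split; last by move=> a; apply: leq_trans (mL'' a) _; lia.
exists (bitlen i + bitlen (m1 i) + t + u)%N; first exact: ExecWhileTrue pt qu.
by have := mL i; nia.
Qed.

(* Registers are the cells of negative address, [r] listing -1, -2, ...; *)
(* beyond their ends both lists are padded with zeros.                   *)
Definition layout (r w : seq int) : memory :=
  fun a => match a with Posz k => w`_k | Negz k => r`_k end.

Lemma update_reg (r w : seq int) (k : nat) (v : int) :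
  update (layout r w) (Negz k) v = layout (set_nth 0 r k v) w.
Proof. by apply/funext => -[j|j]; rewrite /update /= ?nth_set_nth. Qed.

Lemma update_cell (r w : seq int) (k : nat) (v : int) :
  update (layout r w) (Posz k) v = layout r (set_nth 0 w k v).
Proof. by apply/funext => -[j|j]; rewrite /update /= ?nth_set_nth. Qed.

(** Eight registers suffice for the reduction; the 4 bits of their addresses explain [4 <= L] in
    [runs]. *)
Lemma bitlen_reg (k : nat) : (k < 8)%N -> (bitlen (Negz k) <= 4)%N.
Proof. by do 8 (case: k => // k). Qed.

Section Instructions.
Variables (r w : seq int) (n : nat) (q : program) (m : memory) (a i j k : nat).

(** The instruction rules are in continuation form: applying one executes the head of the program
    symbolically and leaves the tail [q] to be run from the updated lists. *)
Let runs_cons p m' : runs 1 p (layout r w) m' -> runs n q m' m ->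
  runs n.+1 (Seq p q) (layout r w) m.
Proof. by rewrite -add1n; apply: runs_seq. Qed.

Hypothesis i8 : (i < 8)%N.

Lemma runs_const c : (bitlen c <= 4)%N -> runs n q (layout (set_nth 0 r i c) w) m ->
  runs n.+1 (Seq (Const (Negz i) c) q) (layout r w) m.
Proof.
move=> c4; rewrite -update_reg; apply: runs_cons.
apply: runs_update (ExecConst _ _ _) _ => L L4 mL.
by have := bitlen_reg i8; split; lia.
Qed.

Hypothesis j8 : (j < 8)%N.

Lemma runs_read : r`_j = a ->
  runs n q (layout (set_nth 0 r i w`_a) w) m ->
  runs n.+1 (Seq (Read (Negz i) (Negz j)) q) (layout r w) m.
Proof.
move=> ja; rewrite -update_reg; apply: runs_cons.
have -> : w`_a = layout r w (layout r w (Negz j)) by rewrite /= ja.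
apply: runs_update (ExecRead _ _ _) _ => L L4 mL.
have iL := bitlen_reg i8; have jL := bitlen_reg j8.
have vL := mL (Negz j); have aL := mL (layout r w (Negz j)).
by split; [move: iL jL vL aL; do 4 move: (bitlen _) => ?; lia | exact: leqW].
Qed.

Lemma runs_write : r`_i = a ->
  runs n q (layout r (set_nth 0 w a r`_j)) m ->
  runs n.+1 (Seq (Write (Negz i) (Negz j)) q) (layout r w) m.
Proof.
move=> ia; rewrite -update_cell; apply: runs_cons.
have -> : update (layout r w) a r`_j =
    update (layout r w) (layout r w (Negz i)) (layout r w (Negz j)).
  by rewrite /= ia.
apply: runs_update (ExecWrite _ _ _) _ => L L4 mL.
have iL := bitlen_reg i8; have jL := bitlen_reg j8.
have vL := mL (Negz i); have aL := mL (Negz j).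
by split; [move: iL jL vL aL; do 4 move: (bitlen _) => ?; lia | exact: leqW].
Qed.

Hypothesis k8 : (k < 8)%N.

Let runs_arith (op : program) (b v : int) :
  exec op (layout r w) (bitlen b + bitlen (Negz j) + bitlen (Negz k) + bitlen r`_j + bitlen r`_k)
    (update (layout r w) b v) ->
  v = r`_j + r`_k \/ v = r`_j - r`_k -> (bitlen b <= 4)%N ->
  runs 1 op (layout r w) (update (layout r w) b v).
Proof.
move=> ex Hv b4; apply: runs_update ex _ => L L4 mL.
have := bitlen_reg j8; have := bitlen_reg k8.
have := mL (Negz j); have := mL (Negz k) => /= jL kL.
have [] := bitlen_addsub kL jL.
by case: Hv => -> *; split => //; lia.
Qed.

Lemma runs_add : runs n q (layout (set_nth 0 r i (r`_j + r`_k)) w) m ->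
  runs n.+1 (Seq (Add (Negz i) (Negz j) (Negz k)) q) (layout r w) m.
Proof.
rewrite -update_reg; apply: runs_cons.
by apply: runs_arith (ExecAdd _ _ _ _) (or_introl erefl) (bitlen_reg i8).
Qed.

Lemma runs_sub : runs n q (layout (set_nth 0 r i (r`_j - r`_k)) w) m ->
  runs n.+1 (Seq (Defs.Sub (Negz i) (Negz j) (Negz k)) q) (layout r w) m.
Proof.
rewrite -update_reg; apply: runs_cons.
by apply: runs_arith (ExecSub _ _ _ _) (or_intror erefl) (bitlen_reg i8).
Qed.

End Instructions.

(** * The program computing the reduction *)

Section Program.

Local Notation one := (Negz 0).
Local Notation count := (Negz 1).
Local Notation ptr := (Negz 2).
Local Notation tmp := (Negz 3).
Local Notation weight := (Negz 4).
Local Notation total := (Negz 5).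
Local Notation ptr' := (Negz 6).
Local Notation zero := (Negz 7).
Local Notation "p ;; q" := (Seq p q) (at level 61, right associativity).

Definition add_abs (i : int) : program :=
  If i (Add weight weight i ;; Skip) (Defs.Sub weight weight i ;; Skip).

Lemma runs_add_abs (r w : seq int) (n i : nat) (q : program) (m : memory) :
  (i < 8)%N -> runs n q (layout (set_nth 0 r 4 (r`_4 + `|r`_i|)) w) m ->
  runs n.+3 (add_abs (Negz i) ;; q) (layout r w) m.
Proof.
move=> i8 H; rewrite -addn3 addnC; apply: runs_seq H.
apply: runs_if (bitlen_reg i8) _ => /=; case: ltrP => ri.
- by apply: runs_add => //; rewrite gtr0_norm //; apply: runs_skip.
- by apply: runs_sub => //; rewrite ler0_norm //; apply: runs_skip.
Qed.

(** One pass yields both parameters: [total] loses each item [a], while [weight] gains [|a + a|],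
    the doubling standing in for a multiplication. *)
Definition scan : program :=
  While count
    (Read tmp ptr ;; Defs.Sub total total tmp ;; Add tmp tmp tmp ;; add_abs tmp ;;
     Add ptr ptr one ;; Defs.Sub count count one ;; Skip).

(** The induction moves items from [s] to the scanned prefix [w], so the word itself stays fixed;
    [v'] is the leftover of [tmp]. *)
Lemma runs_scan (s w : seq int) (v M H : int) : exists v' : int,
  runs (10 * size s + 1) scan
    (layout [:: 1; (size s)%:Z; (size w)%:Z; v; M; H; 0; 0] (w ++ s))
    (layout [:: 1; 0; (size (w ++ s))%:Z; v'; M + 2 * \sum_(a <- s) `|a|;
             H - \sum_(a <- s) a; 0; 0] (w ++ s)).
Proof.
elim: s w v M H => [|a s IHs] w v M H.
  exists v; rewrite !big_nil cats0 mulr0 addr0 subr0.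
  exact: runs_while_stop.
have [v'] := IHs (rcons w a) (a + a) (M + `|a + a|) (H - a).
rewrite cat_rcons -addrA -addrA -opprD => IH.
exists v'; rewrite !big_cons.
have -> : 2 * (`|a| + \sum_(j <- s) `|j|) = `|a + a| + 2 * \sum_(j <- s) `|j| by lia.
have -> : (10 * size (a :: s) + 1 = (9 + (10 * size s + 1)).+1)%N by rewrite /=; lia.
apply: runs_while_step IH => //.
apply: (runs_read (a := size w)) => //=.
rewrite nth_cat ltnn subnn /=.
apply: runs_sub => //=; apply: runs_add => //=; apply: runs_add_abs => //=.
apply: runs_add => //=; apply: runs_sub => //=.
rewrite size_rcons -[(size s).+1]addn1 PoszD addrK -[(size w).+1]addn1 PoszD.
exact: runs_skip.
Qed.

(** Round [i] starts with [weight] equal to [2 M 8^i]; two doublings give [w_i], added to the item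
    in place and to [total], and a third gives [q_i], appended at [ptr]. *)
Definition emit : program :=
  While count
    (Add weight weight weight ;; Add weight weight weight ;;
     Read tmp ptr' ;; Add tmp tmp weight ;; Write ptr' tmp ;;
     Add total total weight ;; Add weight weight weight ;; Write ptr weight ;;
     Add ptr ptr one ;; Add ptr' ptr' one ;; Defs.Sub count count one ;; Skip).

(** These are the [p_i]. The exponent [i.+1] reserves digit 0 for [M] and [2 * M]. *)
Definition shifted_items (M : int) (s : seq int) : seq int :=
  mkseq (fun i => s`_i + M * 8 ^+ i.+1) (size s).

Definition digit_items (M : int) (n : nat) : seq int :=
  mkseq (fun i => 2 * M * 8 ^+ i.+1) n.

Lemma mkseqS (f : nat -> int) (n : nat) :
  mkseq f n.+1 = f 0%N :: mkseq (fun i => f i.+1) n.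
Proof. by rewrite /mkseq /= (iotaDl 1) -map_comp. Qed.

Lemma set_nth_size_cat (w s : seq int) (a b : int) :
  set_nth 0 (w ++ a :: s) (size w) b = w ++ b :: s.
Proof. by elim: w => //= c w ->. Qed.

Lemma set_nth_size (s : seq int) (b : int) : set_nth 0 s (size s) b = rcons s b.
Proof. by elim: s => //= c s ->. Qed.

Lemma runs_emit (s w u : seq int) (v M T : int) : exists v' W' : int,
  runs (13 * size s + 1) emit
    (layout [:: 1; (size s)%:Z; (size (w ++ s ++ u))%:Z; v; 2 * M; T; (size w)%:Z; 0]
       (w ++ s ++ u))
    (layout [:: 1; 0; (size (w ++ s ++ u) + size s)%:Z; v'; W';
             T + \sum_(i < size s) M * 8 ^+ i.+1; (size (w ++ s))%:Z; 0]
       (w ++ shifted_items M s ++ u ++ digit_items M (size s))).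
Proof.
elim: s w u v M T => [|a s IHs] w u v M T.
  exists v, (2 * M); rewrite big_ord0 addr0 addn0 !cats0.
  exact: runs_while_stop.
(* The later rounds are the same loop with [M * 8] in place of [M]. *)
have [v' [W']] := IHs (rcons w (a + M * 8)) (rcons u (2 * M * 8)) (a + M * 8) (M * 8) (T + M * 8).
have -> : \sum_(i < size s) M * 8 * 8 ^+ i.+1 = \sum_(i < size s) M * 8 ^+ i.+2.
  by apply: eq_bigr => i _; rewrite [in RHS]exprS; ring.
have -> : shifted_items (M * 8) s = mkseq (fun i => s`_i + M * 8 ^+ i.+2) (size s).
  by apply: eq_map => i; rewrite [in RHS]exprS; ring.
have -> : digit_items (M * 8) (size s) = mkseq (fun i => 2 * M * 8 ^+ i.+2) (size s).
  by apply: eq_map => i; rewrite [in RHS]exprS; ring.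
rewrite -addrA !cat_rcons => IH; exists v', W'.
rewrite /shifted_items /digit_items [size (a :: s)]/= big_ord_recl !mkseqS /=.
have -> : (13 * (size s).+1 + 1 = (12 + (13 * size s + 1)).+1)%N by lia.
have e1 : size (w ++ (a + M * 8) :: s ++ rcons u (2 * M * 8)) = (size (w ++ a :: s ++ u)).+1.
  by rewrite -!cat_rcons !(size_cat, size_rcons); lia.
have e2 : size (w ++ (a + M * 8) :: s) = size (w ++ a :: s) by rewrite !size_cat.
rewrite e1 e2 addSnnS in IH.
apply: runs_while_step IH => //.
apply: runs_add => //=; apply: runs_add => //=.
apply: (runs_read (a := size w)) => //=; rewrite nth_cat ltnn subnn /=.
apply: runs_add => //=; apply: (runs_write (a := size w)) => //=.
rewrite set_nth_size_cat.
apply: runs_add => //=; apply: runs_add => //=.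
apply: (runs_write (a := size (w ++ a :: s ++ u))) => //=.
have -> : size (w ++ a :: s ++ u) = size (w ++ (a + (2 * M + 2 * M + (2 * M + 2 * M))) :: s ++ u).
  by rewrite !size_cat.
rewrite set_nth_size !rcons_cat rcons_cons rcons_cat.
apply: runs_add => //=; apply: runs_add => //=; apply: runs_sub => //=.
have -> : 2 * M + 2 * M + (2 * M + 2 * M) = M * 8 by ring.
rewrite size_rcons -[(size s).+1]addn1 -[(size w).+1]addn1 -[(size (w ++ _)).+1]addn1.
rewrite !PoszD addrK -mulrA mulr2n mulrDl !mul1r.
exact: runs_skip.
Qed.

(* The factor 3, matched by [M] and [2 * M], keeps the list duplicate-free and *)
(* both sides nonempty even for [s = [::]].                                    *)
Definition items (H M : int) (s : seq int) : seq int :=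
  (H + 3 * M + \sum_(i < size s) M * 8 ^+ i.+1) ::
  shifted_items M s ++ [:: M; 2 * M] ++ digit_items M (size s).

Lemma size_items (H M : int) (s : seq int) : size (items H M s) = (2 * size s + 3)%N.
Proof. by rewrite /= size_cat /= !size_mkseq; lia. Qed.

Definition modulus (t : int) (s : seq int) : int :=
  1 + 2 * `|t| + 2 * \sum_(a <- s) `|a|.

Definition reduced_items (t : int) (s : seq int) : seq int :=
  items (2 * t - \sum_(a <- s) a) (modulus t s) s.

(** Working in place dictates the order in [items]: [T] replaces the target in cell 1 and the [p_i]
    overwrite the [a_i]. The final [Const] instructions erase the registers, because the solver is
    specified only on memories of the form [init w]. *)
Definition reduction : program :=
  Const zero 0 ;; Const one 1 ;; Read count zero ;; Read tmp one ;;
  Add total tmp tmp ;; Add weight one zero ;; add_abs total ;; Add ptr one one ;;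
  scan ;;
  Write ptr weight ;; Add ptr ptr one ;; Add total total weight ;;
  Add weight weight weight ;;
  Write ptr weight ;; Add ptr ptr one ;; Add total total weight ;;
  Add ptr' one one ;; Read count zero ;;
  emit ;;
  Defs.Sub count ptr one ;; Write zero count ;; Write one total ;;
  Const one 0 ;; Const count 0 ;; Const ptr 0 ;; Const tmp 0 ;; Const weight 0 ;;
  Const total 0 ;; Const ptr' 0 ;; Skip.

Lemma layout_nil (k : nat) (w : seq int) : layout (nseq k 0) w = init w.
Proof. by apply/funext => -[j|j] //=; rewrite nth_nseq if_same. Qed.

Lemma runs_reduction (s : seq int) (t : int) :
  runs (23 * size s + 40) reduction (init ((size s)%:Z :: t :: s))
    (init ((size (reduced_items t s))%:Z :: reduced_items t s)).
Proof.
(* The register list starts empty; writing register 7 first pads it to length 8, the length it has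
   at the end. *)
rewrite -(layout_nil 0) -(layout_nil 8).
set n := size s; set t2 := t + t.
have [v scanP] := runs_scan s [:: n%:Z; t] t (1 + 0 + `|t2|) t2.
have [v' [W emitP]] := runs_emit s [:: n%:Z; t] [:: modulus t s; 2 * modulus t s]
  v (modulus t s) (2 * t - \sum_(a <- s) a + 3 * modulus t s).
(* The straight-line blocks around the two loops take 10, 9 and 11 steps, [add_abs] counting for 3;
   the last 8 is slack. *)
have -> : (23 * n + 40 =
   10 + (10 * n + 1 + (9 + (13 * n + 1 + 11))) + 8)%N by lia.
apply: (@runs_le (10 + (10 * n + 1 + (9 + (13 * n + 1 + 11))))); first exact: leq_addr.
apply: runs_const => //=; apply: runs_const => //=; apply: (runs_read (a := 0%N)) => //=.
apply: (runs_read (a := 1%N)) => //=; apply: runs_add => //=; apply: runs_add => //=.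
apply: runs_add_abs => //=; apply: runs_add => //=.
apply: runs_seq scanP _; rewrite /=.
have -> : 1 + 0 + `|t2| + 2 * \sum_(a <- s) `|a| = modulus t s by rewrite /modulus /t2; lia.
apply: (runs_write (a := size [:: n%:Z, t & s])) => //=.
rewrite set_nth_size.
do 3 apply: runs_add => //=.
apply: (runs_write (a := (size (rcons s (modulus t s))).+2)) => /=; try by rewrite ?size_rcons; lia.
rewrite set_nth_size -!cats1 -catA /=.
do 3 apply: runs_add => //=.
apply: (runs_read (a := 0%N)) => //=.
have tE : t2 - \sum_(a <- s) a + modulus t s + (modulus t s + modulus t s) =
    2 * t - \sum_(a <- s) a + 3 * modulus t s by rewrite /t2; ring.
have sE : (size s).+2%:Z + 1 + 1 =
    size ([:: n%:Z; t] ++ s ++ [:: modulus t s; 2 * modulus t s]).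
  by rewrite !size_cat /=; lia.
have dE : modulus t s + modulus t s = 2 * modulus t s by ring.
rewrite tE sE dE; apply: runs_seq emitP _ => /=.
apply: runs_sub => //=.
apply: (runs_write (a := 0%N)) => //=.
apply: (runs_write (a := 1%N)) => //=.
do 7 apply: runs_const => //=.
rewrite (_ : Posz _ - 1 = (size (reduced_items t s))%:Z).
  exact: runs_skip.
by rewrite /= !size_cat /= !size_mkseq; lia.
Qed.

End Program.

(** * Correctness of the reduction *)

(** The lowest digit is a multiple of 8 of absolute value at most 6, hence 0; dividing by 8 leaves
    the same problem for the other digits. *)
Lemma digits_eq0 (n : nat) (d : nat -> int) : (forall i, `|d i| <= 6) ->
  \sum_(i < n) d i * 8 ^+ i = 0 -> forall i, (i < n)%N -> d i = 0.
Proof.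
elim: n d => [|n IHn] d d6 // S0 i.
have {}S0 : d 0%N + 8 * (\sum_(i < n) d i.+1 * 8 ^+ i) = 0.
  rewrite -[RHS]S0 big_ord_recl expr0 mulr1 mulr_sumr; congr (_ + _).
  by apply: eq_bigr => j _; rewrite [in RHS]exprS; ring.
have := d6 0%N; case: i => [|i] d06 lt_in; first by lia.
by apply: (IHn (fun i => d i.+1)) lt_in => //; lia.
Qed.

Lemma sum_nth_cat (f : nat -> int) (u w : seq int) :
  \sum_(k < size (u ++ w)) f k * (u ++ w)`_k =
  \sum_(k < size u) f k * u`_k + \sum_(k < size w) f (size u + k)%N * w`_k.
Proof.
rewrite size_cat big_split_ord; congr (_ + _); apply: eq_bigr => k _ /=.
  by rewrite nth_cat ltn_ord.
by rewrite nth_cat ltnNge leq_addr addKn.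
Qed.

Lemma sum_nth_mkseq (f g : nat -> int) (n : nat) :
  \sum_(k < size (mkseq g n)) f k * (mkseq g n)`_k = \sum_(k < n) f k * g k.
Proof. by rewrite size_mkseq; apply: eq_bigr => k _; rewrite nth_mkseq. Qed.

(** The signs [e], [x_i], [z], [z'], [y_i] are [f] at [0], [i.+1], [n.+1], [n.+2], [(n + i).+3]. *)
Lemma sum_items (H M : int) (s : seq int) (f : nat -> int) (n := size s) :
  \sum_(k < size (items H M s)) f k * (items H M s)`_k =
  (f 0%N * H + \sum_(i < n) f i.+1 * s`_i) +
  M * ((3 * f 0%N + f n.+1 + 2 * f n.+2) +
       \sum_(i < n) (f 0%N + f i.+1 + 2 * f (n + i).+3) * 8 ^+ i.+1).
Proof.
rewrite /items -cat1s sum_nth_cat big_ord1 /=.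
rewrite (sum_nth_cat (fun k => f k.+1)) (sum_nth_mkseq (fun k => f k.+1)) size_mkseq -/n.
rewrite (sum_nth_cat (fun k => f (n + k).+1) [:: M; 2 * M]).
rewrite (sum_nth_mkseq (fun k => f (n + k.+2).+1)) big_ord_recl big_ord1 /=.
rewrite /bump /= addn0 addn1.
have -> : \sum_(i < n) f i.+1 * (s`_i + M * 8 ^+ i.+1) =
    \sum_(i < n) f i.+1 * s`_i + \sum_(i < n) f i.+1 * (M * 8 ^+ i.+1).
  by rewrite -big_split; apply: eq_bigr => i _; rewrite mulrDr.
rewrite [M * (_ + _ + _ + _)]mulrDr.
have -> : M * (\sum_(i < n) (f 0%N + f i.+1 + 2 * f (n + i).+3) * 8 ^+ i.+1) =
    f 0%N * (\sum_(i < n) M * 8 ^+ i.+1) + \sum_(i < n) f i.+1 * (M * 8 ^+ i.+1) +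
    \sum_(i < n) f (n + i.+2).+1 * (2 * M * 8 ^+ i.+1).
  rewrite !mulr_sumr -!big_split; apply: eq_bigr => i _ /=.
  by rewrite !addnS; ring.
ring.
Qed.

Lemma items_zero_sum (H M : int) (s : seq int) (f : nat -> int) (n := size s) :
  `|H| + \sum_(a <- s) `|a| < M -> (forall k, `|f k| <= 1) ->
  \sum_(k < size (items H M s)) f k * (items H M s)`_k = 0 ->
  (forall k, (k < size (items H M s))%N -> f k = 0) \/
  [/\ f 0%N != 0, f n.+1 = - f 0%N, f n.+2 = - f 0%N,
      f 0%N * H + \sum_(i < n) f i.+1 * s`_i = 0 &
      forall i, (i < n)%N -> `|f i.+1| = 1].
Proof.
move=> HM f1; rewrite sum_items -/n.
set low := (X in X + M * _); set high := (X in M * X) => eq0.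
have low_lt : `|low| < M.
  apply: le_lt_trans HM; apply: le_trans (ler_normD _ _) _; apply: lerD.
    by rewrite normrM ler_piMl.
  apply: le_trans (ler_norm_sum _ _ _) _; rewrite (big_nth 0) big_mkord.
  by apply: ler_sum => i _; rewrite normrM ler_piMl.
(* Otherwise [|low| = M * |high| >= M]. *)
have high0 : high = 0.
  apply/eqP/negP => /negP h0; have lowE : low = - (M * high) by apply/eqP; rewrite -addr_eq0 eq0.
  have h1 : 1 <= `|high| by lia.
  by move: low_lt; rewrite lowE normrN normrM ltNge => /negP; apply; nia.
have low0 : low = 0 by move: eq0; rewrite high0 mulr0 addr0.
pose d i := if i is j.+1 then f 0%N + f j.+1 + 2 * f (n + j).+3
            else 3 * f 0%N + f n.+1 + 2 * f n.+2.
have d0 : forall i, (i < n.+1)%N -> d i = 0.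
  apply: digits_eq0 => [[|j] /=|].
  - by have := f1 0%N; have := f1 n.+1; have := f1 n.+2; lia.
  - by have := f1 0%N; have := f1 j.+1; have := f1 (n + j).+3; lia.
  - by rewrite big_ord_recl expr0 mulr1.
have d00 := d0 0%N isT; rewrite /= in d00.
have [f00|f0] := eqVneq (f 0%N) 0; [left => k | right].
  rewrite size_items -/n => kN.
  have [k0|] := posnP k; first by rewrite k0.
  have := f1 n.+1; have := f1 n.+2; rewrite f00 in d00 => b2 b1.
  have [kn k0|] := leqP k n.
    case: k kN k0 kn => // k _ _ kn; have := d0 k.+1 kn; rewrite /= f00.
    by have := f1 k.+1; have := f1 (n + k).+3; lia.
  rewrite leq_eqVlt => /predU1P [<-|]; first by lia.
  rewrite leq_eqVlt => /predU1P [<-|nk k0]; first by lia.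
  have kE : k = (n + (k - n.+3)).+3 by lia.
  have := d0 (k - n.+3).+1; rewrite /= -kE f00 => /(_ ltac:(lia)).
  by have := f1 k; have := f1 (k - n.+3).+1; lia.
have := f1 0%N; have := f1 n.+1; have := f1 n.+2; split => //; try lia.
move=> i lt_in; have := d0 i.+1 lt_in; rewrite /=.
by have := f1 i.+1; have := f1 (n + i).+3; lia.
Qed.

(** Equal entries at [i] and [j] would give a zero signed sum with exactly two nonzero signs,
    whereas [items_zero_sum] allows either none or at least the three at [0], [n.+1] and [n.+2]. *)
Lemma uniq_items (H M : int) (s : seq int) :
  `|H| + \sum_(a <- s) `|a| < M -> uniq (items H M s).
Proof.
move=> HM; apply/(uniqP 0) => i j; rewrite !inE => iN jN eq_ij.
have [//|ij] := eqVneq i j.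
pose f k : int := (k == i)%:R - (k == j)%:R.
have sum1 l : (l < size (items H M s))%N ->
    \sum_(k < size (items H M s)) ((k : nat) == l)%:R * (items H M s)`_k = (items H M s)`_l.
  move=> lN; rewrite (bigD1 (Ordinal lN)) //= eqxx mul1r big1 ?addr0 // => k.
  by rewrite -val_eqE /= => /negbTE ->; rewrite mul0r.
have [k|||] := @items_zero_sum H M s f HM.
- by rewrite /f; do 2 case: (_ == _).
- rewrite /f; under eq_bigr do rewrite mulrBl.
  by rewrite sumrB !sum1 // eq_ij subrr.
- by move=> /(_ i iN); rewrite /f eqxx (negbTE ij).
- case=> f0 f1 f2 _ _.
  have fN0 k : f k != 0 -> k = i \/ k = j.
    by rewrite /f; have [->|_] := eqVneq k i; [left | have [->|] := eqVneq k j; [right|]].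
  have [] := (fN0 0%N f0, fN0 (size s).+1, fN0 (size s).+2).
  by rewrite f1 f2 oppr_eq0 => -[h0 /(_ f0) h1] /(_ f0) h2; lia.
Qed.

Lemma sum_fset_filter (w : seq int) (A : {fset int}) :
  uniq w -> (A `<=` [fset x in w])%fset ->
  \sum_(x <- A) x = \sum_(x <- w | x \in A) x.
Proof.
move=> uw Aw; rewrite -[RHS]big_filter; apply: perm_big; apply: uniq_perm => //.
  exact: filter_uniq.
move=> x; rewrite mem_filter; case: (boolP (x \in A)) => //= xA.
by have := fsubsetP Aw _ xA; rewrite !inE.
Qed.

Lemma sum_subset_index (w : seq int) (P : pred nat) (uw : uniq w) :
  \sum_(x <- [fset x in w | P (index x w)]%fset) x = \sum_(k < size w | P k) w`_k.
Proof.
rewrite (sum_fset_filter uw); last by apply/fsubsetP => x; rewrite !inE => /andP [].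
rewrite (big_nth 0) big_mkord; apply: eq_bigl => k.
by rewrite !inE /= mem_nth //= index_uniq.
Qed.

Lemma equal_subset_sums_signs (w : seq int) : uniq w ->
  has_equal_subset_sums [fset x in w]%fset <->
  exists f : nat -> int,
    [/\ forall k, `|f k| <= 1, \sum_(k < size w) f k * w`_k = 0,
        exists2 k, (k < size w)%N & f k = 1 & exists2 k, (k < size w)%N & f k = -1].
Proof.
move=> uw; split.
- case=> A [B [[Aw Bw] /fdisjointP dAB /fset0Pn [x xA] /fset0Pn [y yB] sAB]].
  pose f k : int := (w`_k \in A)%:R - (w`_k \in B)%:R.
  have dBA z : z \in B -> z \notin A by move=> zB; apply/negP => /dAB /negP.
  exists f; split.
  + by move=> k; rewrite /f; do 2 case: (_ \in _).
  + have sumE C : (C `<=` [fset x in w])%fset ->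
        \sum_(k < size w) (w`_k \in C)%:R * w`_k = \sum_(x <- C) x.
      move=> Cw; rewrite (sum_fset_filter uw Cw) (big_nth 0) big_mkord [RHS]big_mkcond.
      by apply: eq_bigr => k _; case: (_ \in _); rewrite ?mul1r ?mul0r.
    under eq_bigr do rewrite mulrBl.
    by rewrite sumrB !sumE // sAB subrr.
  + have xw : x \in w by have := fsubsetP Aw _ xA; rewrite !inE.
    exists (index x w); first by rewrite index_mem.
    by rewrite /f nth_index // xA (negbTE (dAB _ xA)).
  + have yw : y \in w by have := fsubsetP Bw _ yB; rewrite !inE.
    exists (index y w); first by rewrite index_mem.
    by rewrite /f nth_index // yB (negbTE (dBA _ yB)).
- case=> f [f1 f0 [i iw fi] [j jw fj]].
  exists [fset x in w | f (index x w) == 1]%fset, [fset x in w | f (index x w) == -1]%fset.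
  split.
  + by split; apply/fsubsetP => x; rewrite !inE => /andP [].
  + by apply/fdisjointP => x; rewrite !inE => /andP [-> /eqP ->].
  + by apply/fset0Pn; exists w`_i; rewrite !inE /= mem_nth //= index_uniq // fi.
  + by apply/fset0Pn; exists w`_j; rewrite !inE /= mem_nth //= index_uniq // fj.
  + rewrite (sum_subset_index (fun k => f k == 1) uw).
    rewrite (sum_subset_index (fun k => f k == -1) uw).
    apply: subr0_eq; rewrite -[RHS]f0 [X in X - _]big_mkcond [X in _ - X]big_mkcond -sumrB.
    apply: eq_bigr => k _; have := f1 k.
    have [-> _|n1] := eqVneq (f k) 1; first by rewrite mul1r subr0.
    have [-> _|n2 f1k] := eqVneq (f k) (-1); first by rewrite mulN1r sub0r.
    by rewrite (_ : f k = 0) ?mul0r ?subr0 //; lia.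
Qed.

Lemma modulus_gt (t : int) (s : seq int) :
  `|2 * t - \sum_(a <- s) a| + \sum_(a <- s) `|a| < modulus t s.
Proof.
have := ler_norm_sum s id xpredT; rewrite /modulus.
set x := \sum_(a <- s) a; set y := \sum_(a <- s) `|a| => xy; lia.
Qed.

Lemma uniq_reduced_items (t : int) (s : seq int) : uniq (reduced_items t s).
Proof. exact: uniq_items (modulus_gt t s). Qed.

Lemma reduction_correct (t : int) (s : seq int) : uniq s ->
  has_equal_subset_sums [fset x in reduced_items t s]%fset <->
  has_subset_sum [fset x in s]%fset t.
Proof.
move=> us; pose n := size s; pose H := 2 * t - \sum_(a <- s) a.
rewrite (equal_subset_sums_signs (uniq_reduced_items t s)); split.
- case=> f [f1 f0 [i iN fi] _].
  have [/(_ i iN)|] := items_zero_sum (modulus_gt t s) f1 f0; first by rewrite fi.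
  case=> f00 _ _ eqH fs.
  exists [fset x in s | f (index x s).+1 == - f 0%N]%fset.
    by apply/fsubsetP => x; rewrite !inE => /andP [].
  rewrite (sum_subset_index (fun k => f k.+1 == - f 0%N) us).
  (* Each [x_k] is [- e] on the chosen set and [e] off it, so the sum is [- e] times the chosen part
     minus the rest. *)
  have : \sum_(k < n) f k.+1 * s`_k =
      - f 0%N * (2 * (\sum_(k < n | f k.+1 == - f 0%N) s`_k) - \sum_(a <- s) a).
    rewrite (big_nth 0) big_mkord [X in 2 * X]big_mkcond mulr_sumr -sumrB mulr_sumr.
    apply: eq_bigr => k _; have := fs k (ltn_ord k); have := f1 0%N.
    case: eqP => [-> _ _|]; first by ring.
    move=> ne f01 fk1; have -> : f k.+1 = f 0%N by lia.
    by ring.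
  move=> sumE; move: eqH; rewrite -/n sumE; set x := \sum_(k < n | _) _.
  by have := f1 0%N; move: f00; nia.
- case=> A As sA.
  (* Here [e = 1], [z = z' = -1], and [(x_i, y_i)] is [(-1, 0)] on [A] and [(1, -1)] off it. *)
  pose f k : int := if k is j.+1 then
      if (j < n)%N then (if s`_j \in A then -1 else 1)
      else if (j < n.+2)%N then -1
      else if s`_(j - n.+2) \in A then 0 else -1
    else 1.
  exists f; split.
  + by case=> [|j] //=; do 3 case: ifP => // _.
  + rewrite sum_items -/n /= ltnn ltnW // !ltnNge leqnSn /= leqnn /=.
    have -> : \sum_(i < n) f i.+1 * s`_i = \sum_(a <- s) a - 2 * t.
      transitivity (\sum_(a <- s) (if a \in A then - a else a)).
        rewrite [RHS](big_nth 0) big_mkord; apply: eq_bigr => i _; rewrite /f ltn_ord.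
        by case: ifP => _; ring.
      rewrite -sA (sum_fset_filter us As) [X in 2 * X]big_mkcond mulr_sumr -sumrB.
      by apply: eq_bigr => a _; case: ifP => _; ring.
    rewrite [\sum_(i < n) _ * 8 ^+ _](_ : _ = 0); first by rewrite /H; ring.
    apply: big1 => i _; rewrite /f ltn_ord !ltnNge !leqW ?leq_addr //=.
    rewrite -[(n + i).+2]/(n.+2 + i)%N addKn.
    by case: (_ \in A); ring.
  + by exists 0%N.
  + exists n.+1; first by rewrite size_items -/n; lia.
    by rewrite /f ltnn leqnSn.
Qed.

(** * Running time *)

Lemma input_size_cells (w : seq int) (L : nat) :
  (forall a, (bitlen (init w a) <= L)%N) -> (\sum_(a <- w) bitlen a <= size w * L)%N.
Proof.
move=> wL; rewrite (big_nth 0) big_mkord -[X in (_ <= X * _)%N]card_ord -sum_nat_const.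
by apply: leq_sum => i _; apply: wL i.
Qed.

Lemma size_le_input_size (w : seq int) : (size w <= \sum_(a <- w) bitlen a)%N.
Proof.
by rewrite -sum1_size; apply: leq_sum.
Qed.

(** The successor accounts for cells outside the word, since [bitlen 0 = 1]. *)
Lemma bitlen_cell_le (w : seq int) (a : int) :
  (bitlen (init w a) <= (\sum_(b <- w) bitlen b).+1)%N.
Proof.
case: a => [k|k] //=; case: (ltnP k (size w)) => kw; last by rewrite nth_default.
by rewrite (big_nth 0) big_mkord (bigD1 (Ordinal kw)) //= leqW // leq_addr.
Qed.

Lemma quadratic_cost_bound (A B C d S T S' : nat) :
  (0 < S)%N -> (T <= A * S ^ 2)%N -> (S' <= B * S ^ 2)%N ->
  (T + 2 * (C * S' ^ d) <= (A + 2 * (C * B ^ d)) * S ^ (2 * d + 2))%N.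
Proof.
move=> S0 TA SB; rewrite mulnDl; apply: leq_add.
  by apply: leq_trans TA _; rewrite leq_mul // leq_pexp2l // leq_addl.
rewrite -!mulnA !leq_mul //; apply: leq_trans (_ : _ <= (B * S ^ 2) ^ d)%N _.
  by case: d => // d; rewrite leq_exp2r.
by rewrite expnMn -expnM leq_mul // leq_pexp2l // leq_addr.
Qed.

Lemma powR_quarter_le (R : realType) (c : R) (n : nat) : 1 <= c < 2 ->
  c `^ ((2 * n + 3)%N%:R / 4) <= 2 * c `^ (n%:R / 2).
Proof.
case/andP => c1 c2; have c0 : 0 < c by lra.
have -> : (2 * n + 3)%N%:R / 4 = n%:R / 2 + 3 / 4 :> R by rewrite natrD natrM; field.
rewrite powRD; last by rewrite (gt_eqF c0) implybT.
rewrite mulrC ler_wpM2r ?powR_ge0 //.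
by apply: le_trans (ltW c2); apply: ler1_powR => //; lra.
Qed.

Theorem theorem7 (R : realType) :
  (exists eps : R, 0 < eps < 2 /\
     solvable_in_Ostar EqualSubsetSum (fun n : nat => (2 - eps) `^ (n%:R / 4))) ->
  (exists eps' : R, 0 < eps' < 2 /\
     solvable_in_Ostar SubsetSum (fun n : nat => (2 - eps') `^ (n%:R / 2))).
Proof.
case=> eps [/andP [eps0 eps2] [p [C [d solve]]]].
(* For eps > 1 the base is raised to 1, so that T n >= 1 absorbs the cost of   *)
(* the reduction.                                                              *)
pose c := Num.max (2 - eps) 1.
have c12 : 1 <= c < 2 by rewrite le_max lexx orbT gt_max; lra.
exists (2 - c); split; first by lra.
(* With [S] the input size, [23 n + 40 <= 63 S] and the new contents have length at most
   [S + 4 + 63 S <= 68 S]; the new word has [2 n + 4 <= 6 S] cells. The 2 before [C] comes from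
   [powR_quarter_le]. *)
exists (Seq reduction p), (5 * 63 * 68 + 2 * (C * (6 * 68) ^ d))%N, (2 * d + 2)%N.
rewrite opprB addrC subrK.
move=> [s t]; set n := size (val s).
pose s' : listed_set := exist (fun w : seq int => uniq w) _ (uniq_reduced_items t (val s)).
have ans : answer (s' : instance EqualSubsetSum) <-> answer ((s, t) : instance SubsetSum).
  exact: reduction_correct (valP s).
have [t2 [m [run2 yes no t2_le]]] := solve s'.
set S := @input_size SubsetSum (s, t); set S' := @input_size EqualSubsetSum s' in t2_le.
have nS : (n + 2 <= S)%N by rewrite addn2; apply: (size_le_input_size [:: n%:Z, t & val s]).
have := @runs_reduction (val s) t (S + 4)%N (leq_addl _ _).
case=> [a|[t1 run1 t1_le] bits].
  by apply: (@leq_trans (S + 1)); rewrite ?leq_add2l // addn1; apply: bitlen_cell_le.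
rewrite -/n in t1_le bits.
have S'_le : (S' <= 6 * 68 * S ^ 2)%N.
  apply: leq_trans (input_size_cells bits) _.
  rewrite -[size _]/(size (reduced_items t (val s))).+1 size_items -/n; nia.
have {}t1_le : (t1 <= 5 * 63 * 68 * S ^ 2)%N by apply: leq_trans t1_le _; nia.
exists (t1 + t2)%N, m; split.
- exact: ExecSeq run1 run2.
- by move=> /ans.
- by move=> no_t; apply: no => /ans.
- have S0 : (0 < S)%N by lia.
  apply: le_trans (_ : (t1 + 2 * (C * S' ^ d))%N%:R * c `^ (n%:R / 2) <= _); last first.
    by rewrite ler_wpM2r ?powR_ge0 // ler_nat quadratic_cost_bound.
  rewrite natrD [X in _ <= X * _]natrD mulrDl lerD //.
    rewrite ler_peMr // -[leLHS](powRr0 c); apply: ler_powR; first by lra.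
    by rewrite divr_ge0.
  apply: le_trans t2_le _; rewrite [(2 * _)%N]mulnC [X in _ <= X * _]natrM -mulrA ler_wpM2l //.
  apply: le_trans (powR_quarter_le n c12).
  rewrite -(size_items (2 * t - \sum_(a <- val s) a) (modulus t (val s))).
  apply: ge0_ler_powR; rewrite ?nnegrE ?le_max ?lexx //; try lra.
  by rewrite divr_ge0.
Qed.
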